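(* Let $A$ be a $3\times 3$ real symmetric positive definite matrix. If $\kappa(A)\le 2+\sqrt{3}$, then $H_3(y)\succeq 0$ for any $y\in\mathbb{R}^3$, and hence the function $K(x)=(x^TAx)(x^TA^{-1}x)$ is convex on $\mathbb{R}^3$.
   Context: $\kappa(A)=\lambda_{\max}(A)/\lambda_{\min}(A)$ denotes the condition number of $A$; $\succeq 0$ means positive semi-definite. Let $0<\lambda_1\le\lambda_2\le\lambda_3$ be the eigenvalues of $A$, and for $i\ne j$ in $\{1,2,3\}$ put $\Delta_{ij}=\Delta_{ji}=\frac{\lambda_j}{\lambda_i}+\frac{\lambda_i}{\lambda_j}$. For $y=(y_1,y_2,y_3)\in\mathbb{R}^3$ define $$H_3(y)=\begin{pmatrix} 3y_1^2+\frac12\Delta_{12}y_2^2+\frac12\Delta_{13}y_3^2 & \Delta_{12}y_1y_2 & \Delta_{13}y_1y_3\\ \Delta_{21}y_2y_1 & \frac12\Delta_{21}y_1^2+3y_2^2+\frac12\Delta_{23}y_3^2 & \Delta_{23}y_2y_3\\ \Delta_{31}y_3y_1 & \Delta_{32}y_3y_2 & \frac12\Delta_{31}y_1^2+\frac12\Delta_{32}y_2^2+3y_3^2\end{pmatrix}.$$ *)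

(* Defs.v *)
From HB Require Import structures.
From mathcomp Require Import all_boot all_order all_algebra.
From mathcomp Require Import all_classical all_reals all_analysis.

Set Implicit Arguments.
Unset Strict Implicit.
Unset Printing Implicit Defensive.

Import Order.TTheory GRing.Theory Num.Theory.
Local Open Scope classical_set_scope.
Local Open Scope ring_scope.

Definition quadf (R : realType) (n : nat) (A : 'M[R]_n) (x : 'cV[R]_n) : R :=
  (x^T *m A *m x) 0 0.

Definition posdefmx (R : realType) (n : nat) (A : 'M[R]_n) : Prop :=
  A^T = A /\ forall x : 'cV[R]_n, x != 0 -> 0 < quadf A x.

Definition possemidefmx (R : realType) (n : nat) (A : 'M[R]_n) : Prop :=
  A^T = A /\ forall x : 'cV[R]_n, 0 <= quadf A x.

(* [eigenvalue] refers to left (row) eigenvectors; a square matrix has the same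
   left and right eigenvalues.  For a nonempty finite spectrum the sup and inf
   below are the maximum and the minimum. *)
Definition lambda_max (R : realType) (n : nat) (A : 'M[R]_n) : R :=
  sup [set a : R | eigenvalue A a].

Definition lambda_min (R : realType) (n : nat) (A : 'M[R]_n) : R :=
  inf [set a : R | eigenvalue A a].

Definition cond_number (R : realType) (n : nat) (A : 'M[R]_n) : R :=
  lambda_max A / lambda_min A.

(* The characteristic polynomial makes the list count multiplicities. *)
Definition ordered_eigenvalues (R : realType) (n : nat) (A : 'M[R]_n)
    (lam : 'I_n -> R) : Prop :=
  char_poly A = \prod_(i < n) ('X - (lam i)%:P) /\
  (forall i j : 'I_n, (i <= j)%N -> lam i <= lam j).

Definition Delta (R : realType) (n : nat) (lam : 'I_n -> R) (i j : 'I_n) : R :=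
  lam j / lam i + lam i / lam j.

Definition H3 (R : realType) (lam : 'I_3 -> R) (y : 'cV[R]_3) : 'M[R]_3 :=
  \matrix_(i < 3, j < 3)
    if i == j
    then 3 * y i 0 ^+ 2
         + \sum_(k < 3 | k != i) 2^-1 * Delta lam i k * y k 0 ^+ 2
    else Delta lam i j * y i 0 * y j 0.

Definition Kfun (R : realType) (n : nat) (A : 'M[R]_n) (x : 'cV[R]_n) : R :=
  quadf A x * quadf (invmx A) x.

(* Main.v *)
Require Import Defs.
From HB Require Import structures.
From mathcomp Require Import all_boot all_order all_algebra.
From mathcomp Require Import all_classical all_reals all_analysis.
From mathcomp Require Import ring lra.
Set Implicit Arguments.
Unset Strict Implicit.
Unset Printing Implicit Defensive.

Import Order.TTheory GRing.Theory Num.Theory.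
Local Open Scope classical_set_scope.
Local Open Scope ring_scope.

(** The Hessian of K(x) = a(x) b(x), where a and b are the quadratic forms of A
and A^-1, is 2 (a(v) b(x) + a(x) b(v) + 4 a(x,v) b(x,v)) in the direction v, and
this expression can be bounded below without diagonalizing A. If l and L are
the extreme eigenvalues of A, then l^2 b <= a <= L^2 b as quadratic forms, so
that p = a - l^2 b and q = L^2 b - a are positive semidefinite. Writing a and b
as combinations of p and q, Cauchy-Schwarz for p and for q turns the expression
into a quadratic form in p(x,v) and q(x,v) that is nonnegative as soon as
L^2 + l^2 <= 6 L l ([pencil_ineq]); the bound L / l <= 2 + sqrt 3 amounts to
L^2 + l^2 <= 4 L l.

Both conclusions are instances. The quadratic form of 2 H3(y) is the expression
above for a = diag(lam), b = diag(1 / lam) ([quadf_H3]), and the eigenvalues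
lam_i lie between l and L. Convexity of K follows from nonnegativity of its
second derivative on lines, where K is a quartic polynomial, by an explicit
identity ([convex_quadf_mul]).

The sandwich l^2 b <= a <= L^2 b is obtained variationally: the least t with
a <= t b makes t B - A singular, since a nonsingular positive semidefinite
matrix is bounded below by a positive multiple of the identity
([psd_unit_coercive]). For B = A^-1 this gives a vector with A^2 x = t x, hence
the eigenvalue sqrt t of A, and every eigenvalue is bounded by it
([max_rayleigh], [spectral_bounds]). *)

(** * Bilinear forms and semidefinite matrices *)

Definition bform (R : realType) (n : nat) (A : 'M[R]_n) (x y : 'cV[R]_n) : R :=
  (x^T *m A *m y) 0 0.

Section Forms.
Variables (R : realType) (n : nat).
Implicit Types (A B : 'M[R]_n) (x y z : 'cV[R]_n) (s t : R).

Lemma quadfE A x : quadf A x = bform A x x. Proof. by []. Qed.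

Lemma bformDl A x y z : bform A (x + y) z = bform A x z + bform A y z.
Proof. by rewrite /bform linearD !mulmxDl mxE. Qed.

Lemma bformDr A x y z : bform A x (y + z) = bform A x y + bform A x z.
Proof. by rewrite /bform mulmxDr mxE. Qed.

Lemma bformZl A t x y : bform A (t *: x) y = t * bform A x y.
Proof. by rewrite /bform linearZ -!scalemxAl mxE. Qed.

Lemma bformZr A t x y : bform A x (t *: y) = t * bform A x y.
Proof. by rewrite /bform -scalemxAr mxE. Qed.

Lemma bformC A x y : A^T = A -> bform A x y = bform A y x.
Proof.
move=> sA; have -> : bform A x y = ((x^T *m A *m y)^T) 0 0 by rewrite mxE.
by rewrite !trmx_mul trmxK sA mulmxA.
Qed.

Lemma quadfDZ A x y t : A^T = A ->
  quadf A (x + t *: y) = quadf A x + 2 * t * bform A x y + t ^+ 2 * quadf A y.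
Proof.
move=> sA; rewrite !quadfE !(bformDl, bformDr, bformZl, bformZr) (bformC y x sA).
by ring.
Qed.

Lemma quadf_pencil A B s t x :
  quadf (s *: A - t *: B) x = s * quadf A x - t * quadf B x.
Proof.
by rewrite /quadf mulmxBr mulmxBl mxE [X in _ + X]mxE -!scalemxAr -!scalemxAl !mxE.
Qed.

Lemma bform_pencil A B s t x y :
  bform (s *: A - t *: B) x y = s * bform A x y - t * bform B x y.
Proof.
by rewrite /bform mulmxBr mulmxBl mxE [X in _ + X]mxE -!scalemxAr -!scalemxAl !mxE.
Qed.

(** The discriminant argument for the nonnegative polynomial
t |-> quadf A (x + t y). *)
Lemma psd_CauchySchwarz A x y : possemidefmx A ->
  bform A x y ^+ 2 <= quadf A x * quadf A y.
Proof.
move=> [sA pA].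
have h t : 0 <= quadf A x + 2 * t * bform A x y + t ^+ 2 * quadf A y.
  by rewrite -quadfDZ.
have px := pA x; have := pA y; rewrite le0r => /orP[/eqP y0|y0].
  have [->|b0] := eqVneq (bform A x y) 0; first by rewrite y0 mulr0 expr0n.
  (* An affine function of t bounded below is constant: this t sends it to -1. *)
  have := h (- (quadf A x + 1) / (2 * bform A x y)); rewrite y0.
  have -> : 2 * (- (quadf A x + 1) / (2 * bform A x y)) * bform A x y =
    - (quadf A x + 1) by field.
  by lra.
have := h (- bform A x y / quadf A y).
rewrite -(pmulr_lge0 _ y0) => {}h; rewrite -subr_ge0.
apply: (le_trans h); rewrite le_eqVlt; apply/orP; left; apply/eqP.
by field; rewrite gt_eqF.
Qed.

Lemma quadf1E x : quadf 1%:M x = \sum_i x i 0 ^+ 2.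
Proof.
by rewrite /quadf mulmx1 mxE; apply: eq_bigr => i _; rewrite mxE expr2.
Qed.

Lemma quadf1_ge0 x : 0 <= quadf 1%:M x.
Proof. by rewrite quadf1E sumr_ge0 // => i _; rewrite sqr_ge0. Qed.

Lemma quadf1_eq0 x : quadf 1%:M x = 0 -> x = 0.
Proof.
rewrite quadf1E => /eqP; rewrite psumr_eq0 => [/allP h|i _]; last exact: sqr_ge0.
apply/matrixP => i j; rewrite ord1 mxE; apply/eqP.
by have := h i (mem_index_enum i); rewrite sqrf_eq0.
Qed.

Lemma quadf1_gt0 x : x != 0 -> 0 < quadf 1%:M x.
Proof.
by move=> x0; rewrite lt_def quadf1_ge0 andbT; apply: contraNneq x0 => /quadf1_eq0->.
Qed.

Lemma quadf_le_normsq A : exists2 C, 0 < C & forall x, quadf A x <= C * quadf 1%:M x.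
Proof.
exists (1 + \sum_i \sum_j `|A i j|) => [|x].
  by rewrite ltr_pwDl // sumr_ge0 // => i _; rewrite sumr_ge0.
apply: (@le_trans _ _ (\sum_i \sum_j `|A i j| * quadf 1%:M x)).
  rewrite /quadf mxE exchange_big /=; apply: ler_sum => j _.
  rewrite mxE mulr_suml; apply: ler_sum => i _; rewrite mxE.
  rewrite -/(quadf 1%:M x); apply: le_trans (ler_norm _) _.
  have h k : `|x k 0| ^+ 2 <= quadf 1%:M x.
    rewrite quadf1E (bigD1 k) //= real_normK ?num_real// lerDl.
    by rewrite sumr_ge0 // => l _; rewrite sqr_ge0.
  rewrite !normrM mulrAC [X in X <= _]mulrC ler_wpM2l //.
  have := h i; have := h j; set a := `|_|; set b := `|_|.
  by have := sqr_ge0 (a - b); nra.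
have ->: \sum_i \sum_j `|A i j| * quadf 1%:M x =
   (\sum_i \sum_j `|A i j|) * quadf 1%:M x.
  by rewrite mulr_suml; apply: eq_bigr => i _; rewrite mulr_suml.
by rewrite ler_wpM2r ?quadf1_ge0 // lerDr.
Qed.

Lemma quadf_invmx A x : A^T = A -> A \in unitmx ->
  quadf (invmx A) x = quadf A (invmx A *m x).
Proof.
move=> sA uA; rewrite /quadf trmx_mul trmx_inv sA -!mulmxA.
by rewrite (mulKVmx uA).
Qed.

(** With N = |x|^2, Cauchy-Schwarz for A at x and A^-1 x gives
N^2 <= quadf A x * quadf A^-1 x, and the last factor is O(N). This stands in
for a compactness argument on the unit sphere. *)
Lemma psd_unit_coercive A : possemidefmx A -> A \in unitmx ->
  exists2 c, 0 < c & forall x, c * quadf 1%:M x <= quadf A x.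
Proof.
move=> pA uA; have [C C0 hC] := quadf_le_normsq (invmx A).
exists C^-1 => [|x]; first by rewrite invr_gt0.
rewrite ler_pdivrMl //.
have := psd_CauchySchwarz x (invmx A *m x) pA.
rewrite -quadf_invmx ?pA.1 //; have := hC x; have := pA.2 x.
have -> : bform A x (invmx A *m x) = quadf 1%:M x.
  by rewrite /bform /quadf -mulmxA mulKVmx // mulmx1.
have := quadf1_ge0 x; move: (quadf A x) (quadf 1%:M x) (quadf _ x) => a N b.
rewrite le0r => /orP[/eqP-> a0 _ _|N0 a0 bC hN]; first by rewrite mulr_ge0 ?(ltW C0).
rewrite -(ler_pM2r N0) -expr2 (le_trans hN) // mulrC mulrAC ler_wpM2r //.
Qed.

Lemma singular_ker A : A \notin unitmx -> exists2 x : 'cV[R]_n, x != 0 & A^T *m x = 0.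
Proof.
rewrite unitmxE unitfE negbK => /det0P[v v0 vA]; exists v^T.
  by apply: contraNneq v0 => h; rewrite -(trmxK v) h trmx0.
by rewrite -trmx_mul vA trmx0.
Qed.

Lemma posdef_unit A : posdefmx A -> A \in unitmx.
Proof.
move=> [sA pA]; apply/negPn/negP => /singular_ker[x x0]; rewrite sA => Ax.
by have := pA x x0; rewrite /quadf -mulmxA Ax mulmx0 mxE ltxx.
Qed.

Lemma posdef_psd A : posdefmx A -> possemidefmx A.
Proof.
move=> [sA pA]; split=> // x; have [->|/pA/ltW//] := eqVneq x 0.
by rewrite /quadf mulmx0 mxE.
Qed.

Lemma posdef_invmx A : posdefmx A -> posdefmx (invmx A).
Proof.
move=> pA; have uA := posdef_unit pA; split=> [|x x0].
  by rewrite trmx_inv pA.1.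
rewrite quadf_invmx ?pA.1 //; apply: pA.2; apply: contraNneq x0 => h.
by rewrite -(mulKVmx uA x) h mulmx0.
Qed.

(** * Extreme eigenvalues by a variational argument *)

(** The least t with A <= t B is attained by a generalized eigenvector: if
t B - A were nonsingular it would be coercive, and t could be decreased. *)
Lemma max_rayleigh A B : (0 < n)%N -> A^T = A -> posdefmx B ->
  exists t x, [/\ x != 0, A *m x = t *: (B *m x) &
    forall y, quadf A y <= t * quadf B y].
Proof.
move=> n0 sA pB; have psB := posdef_psd pB.
pose S := [set t : R | forall x, quadf A x <= t * quadf B x].
have [C C0 hC] := quadf_le_normsq A; have [D D0 hD] := quadf_le_normsq B.
have [c c0 hc] := psd_unit_coercive psB (posdef_unit pB).
have S0 : S (C / c).
  move=> x; apply: le_trans (hC x) _; rewrite -mulrA ler_wpM2l ?(ltW C0)//.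
  by rewrite ler_pdivlMl.
have lbS y : y != 0 -> lbound S (quadf A y / quadf B y).
  by move=> y0 t /(_ y); rewrite ler_pdivrMr // pB.2.
have [e e0] : exists e : 'cV[R]_n, e != 0.
  exists (const_mx 1); apply/eqP => /matrixP/(_ (Ordinal n0) 0)/eqP.
  by rewrite !mxE oner_eq0.
have infS : S (inf S).
  move=> y; have [->|y0] := eqVneq y 0.
    by rewrite /quadf !mulmx0 mxE mulr0.
  rewrite -ler_pdivrMr ?pB.2 //; apply: lb_le_inf; last exact: lbS.
  by exists (C / c).
set t0 := inf S in infS; pose M := t0 *: B - 1 *: A.
have sM : M^T = M by rewrite /M linearB !linearZ /= sA pB.1.
have pM : possemidefmx M.
  by split=> // x; rewrite quadf_pencil mul1r subr_ge0 infS.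
have [uM|/singular_ker[x x0]] := boolP (M \in unitmx).
  have [k k0 hk] := psd_unit_coercive pM uM.
  have : S (t0 - k / D).
    move=> x; rewrite mulrBl lerBrDr -lerBrDl.
    have := hk x; rewrite quadf_pencil mul1r; apply: le_trans.
    by rewrite -mulrA ler_wpM2l ?(ltW k0) // ler_pdivrMl.
  have := divr_gt0 k0 D0; move=> kD /(@ge_inf _ S); rewrite -/t0.
  have hS : has_lbound S by eexists; apply: lbS e0.
  by move=> /(_ hS); lra.
rewrite sM mulmxBl -!scalemxAl scale1r => /eqP; rewrite subr_eq0 => /eqP h.
by exists t0, x.
Qed.

(** A^2 - s^2 = (A + s) (A - s), and A + s is positive definite. *)
Lemma eigenvalue_of_square A x s : posdefmx A -> 0 < s -> x != 0 ->
  A *m (A *m x) = s ^+ 2 *: x -> eigenvalue A s.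
Proof.
move=> pA s0 x0 AAx.
have uAs : A - (- s)%:M \in unitmx.
  apply: posdef_unit; split=> [|y y0].
    by rewrite linearB /= pA.1 tr_scalar_mx.
  have -> : A - (- s)%:M = 1 *: A - (- s) *: 1%:M.
    by rewrite scale1r scalemx1.
  rewrite quadf_pencil mul1r mulNr opprK addr_gt0 ?pA.2 //.
  by rewrite mulr_gt0 // quadf1_gt0.
apply/eigenvalueP; exists x^T; last first.
  by apply: contraNneq x0 => h; rewrite -(trmxK x) h trmx0.
rewrite -[in LHS]pA.1 -trmx_mul -linearZ; congr _^T.
apply/eqP; rewrite -subr_eq0; apply/eqP.
rewrite -[LHS](mulKmx uAs).
suff -> : (A - (- s)%:M) *m (A *m x - s *: x) = 0 by rewrite mulmx0.
rewrite mulmxBl !mulmxBr AAx !mul_scalar_mx -scalemxAr scalerA !scaleNr.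
by rewrite mulNr scaleNr opprK -expr2 opprD opprK addrA subrK subrr.
Qed.

(** The pencil of A and A^-1, rather than of A and 1, is the one whose extreme
values enter the Hessian of the product of the two forms; its generalized
eigenvectors are those of A^2. *)
Lemma eigenvalue_max A : (0 < n)%N -> posdefmx A ->
  exists L, [/\ 0 < L, eigenvalue A L &
    forall x, quadf A x <= L ^+ 2 * quadf (invmx A) x].
Proof.
move=> n0 pA; have pB := posdef_invmx pA; have uA := posdef_unit pA.
have [t [x [x0 Ax tB]]] := max_rayleigh n0 pA.1 pB.
have t0 : 0 < t.
  by rewrite -(pmulr_lgt0 _ (pB.2 x x0)); apply: lt_le_trans (pA.2 x x0) (tB x).
exists (Num.sqrt t); rewrite sqrtr_gt0; split=> //; last first.
  by move=> y; rewrite sqr_sqrtr ?tB // ltW.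
apply: (@eigenvalue_of_square _ x) => //; first by rewrite sqrtr_gt0.
by rewrite Ax -scalemxAr mulKVmx // sqr_sqrtr // ltW.
Qed.

Lemma eigenvalue_min A : (0 < n)%N -> posdefmx A ->
  exists l, [/\ 0 < l, eigenvalue A l &
    forall x, l ^+ 2 * quadf (invmx A) x <= quadf A x].
Proof.
move=> n0 pA; have pB := posdef_invmx pA; have uA := posdef_unit pA.
have [t [x [x0 Bx tA]]] := max_rayleigh n0 pB.1 pA.
have t0 : 0 < t.
  by rewrite -(pmulr_lgt0 _ (pA.2 x x0)); apply: lt_le_trans (pB.2 x x0) (tA x).
have s0 : (Num.sqrt t)^-1 ^+ 2 = t^-1 by rewrite exprVn sqr_sqrtr // ltW.
exists (Num.sqrt t)^-1; rewrite invr_gt0 sqrtr_gt0; split=> //; last first.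
  by move=> y; rewrite s0 ler_pdivrMl.
apply: (@eigenvalue_of_square _ x) => //; first by rewrite invr_gt0 sqrtr_gt0.
rewrite s0 -[in RHS](mulKVmx uA x) Bx -scalemxAr scalerA mulVf ?scale1r //.
by rewrite gt_eqF.
Qed.

(** The Rayleigh quotient of A against A^-1 at an eigenvector for a is a^2, so
that the bounds on the pencil are bounds on all the eigenvalues. *)
Lemma eigenvalue_quadf A a : posdefmx A -> eigenvalue A a ->
  exists x, [/\ 0 < a, 0 < quadf (invmx A) x & quadf A x = a ^+ 2 * quadf (invmx A) x].
Proof.
move=> pA /eigenvalueP[v vA v0]; have uA := posdef_unit pA.
have Ax : A *m v^T = a *: v^T by rewrite -[in LHS]pA.1 -trmx_mul vA linearZ.
have x0 : v^T != 0 by apply: contraNneq v0 => h; rewrite -(trmxK v) h trmx0.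
exists v^T; have qB := (posdef_invmx pA).2 _ x0; have qA := pA.2 _ x0.
have qE : quadf A v^T = a * quadf 1%:M v^T.
  by rewrite /quadf mulmx1 -mulmxA Ax -scalemxAr mxE.
have a0 : 0 < a by move: qA; rewrite qE pmulr_lgt0 // quadf1_gt0.
split=> //; rewrite qE expr2 -mulrA; congr (_ * _).
rewrite /quadf -!mulmxA mul1mx -{2}(mulKmx uA v^T) Ax.
by rewrite -!scalemxAr mxE.
Qed.

Lemma spectral_bounds A : (0 < n)%N -> posdefmx A ->
  [/\ 0 < lambda_min A <= lambda_max A,
      forall x, lambda_min A ^+ 2 * quadf (invmx A) x <= quadf A x,
      forall x, quadf A x <= lambda_max A ^+ 2 * quadf (invmx A) x &
      forall a, eigenvalue A a -> lambda_min A <= a <= lambda_max A].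
Proof.
move=> n0 pA; have [L [L0 eL hL]] := eigenvalue_max n0 pA.
have [l [l0 el hl]] := eigenvalue_min n0 pA.
have bnd a : eigenvalue A a -> l <= a <= L.
  move=> /(eigenvalue_quadf pA)[x [a0 qB qE]].
  have := hl x; have := hL x; rewrite qE !ler_pM2r //.
  by rewrite !ler_pXn2r ?nnegrE ?(ltW l0) ?(ltW a0) ?(ltW L0) // => -> ->.
have lL : l <= L by have /andP[] := bnd l el.
have -> : lambda_max A = L.
  apply/le_anti/andP; split.
    by apply: ge_sup => [|a /bnd/andP[]//]; exists L.
  by apply: ub_le_sup => //; exists L => a /bnd/andP[].
have -> : lambda_min A = l; last by split=> //; rewrite l0.
apply/le_anti/andP; split; last by apply: lb_le_inf => [|a /bnd/andP[]//]; exists l.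
by apply: ge_inf => //; exists l => a /bnd/andP[].
Qed.

(** * The second variation of a product of two quadratic forms *)

(** With u = |p3 q3|, AM-GM yields p1 q2 + p2 q1 >= 2 u, so the sum is at least
6 L^2 p3^2 + 6 l^2 q3^2 - 2 (L^2 + l^2) u, and the squares contribute at least
12 L l u. *)
Lemma pencil_scalar_ineq (l L p1 p2 p3 q1 q2 q3 : R) :
  0 < l -> 0 < L -> L ^+ 2 + l ^+ 2 <= 6 * L * l ->
  0 <= p1 -> 0 <= p2 -> p3 ^+ 2 <= p1 * p2 ->
  0 <= q1 -> 0 <= q2 -> q3 ^+ 2 <= q1 * q2 ->
  0 <= 2 * L ^+ 2 * (p1 * p2) + 4 * L ^+ 2 * p3 ^+ 2 +
       2 * l ^+ 2 * (q1 * q2) + 4 * l ^+ 2 * q3 ^+ 2 +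
       (L ^+ 2 + l ^+ 2) * (p1 * q2 + p2 * q1) +
       4 * (L ^+ 2 + l ^+ 2) * (p3 * q3).
Proof.
move=> l0 L0 hL p10 p20 hp q10 q20 hq.
have hm : 2 * `|p3 * q3| <= p1 * q2 + p2 * q1.
  rewrite -(@ler_pXn2r _ 2) ?nnegrE //; last by rewrite addr_ge0 // mulr_ge0.
  rewrite exprMn real_normK ?num_real // exprMn.
  have : p3 ^+ 2 * q3 ^+ 2 <= (p1 * p2) * (q1 * q2).
    by apply: ler_pM; rewrite ?sqr_ge0.
  have := sqr_ge0 (p1 * q2 - p2 * q1); set w := p3 ^+ 2 * _.
  by lra.
have h1 : (L ^+ 2 + l ^+ 2) * (2 * `|p3 * q3|) <=
    (L ^+ 2 + l ^+ 2) * (p1 * q2 + p2 * q1).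
  by rewrite ler_wpM2l // addr_ge0 // sqr_ge0.
have h2 : (L ^+ 2 + l ^+ 2) * - `|p3 * q3| <= (L ^+ 2 + l ^+ 2) * (p3 * q3).
  by rewrite ler_wpM2l ?addr_ge0 ?sqr_ge0 // lerNl ler_normr lexx orbT.
have h3 : L ^+ 2 * p3 ^+ 2 <= L ^+ 2 * (p1 * p2) by rewrite ler_wpM2l // sqr_ge0.
have h4 : l ^+ 2 * q3 ^+ 2 <= l ^+ 2 * (q1 * q2) by rewrite ler_wpM2l // sqr_ge0.
have h5 : (L ^+ 2 + l ^+ 2) * `|p3 * q3| <= 6 * L * l * `|p3 * q3|.
  by rewrite ler_wpM2r.
have h6 : 2 * (L * l * `|p3 * q3|) <= L ^+ 2 * p3 ^+ 2 + l ^+ 2 * q3 ^+ 2.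
  have := sqr_ge0 (L * `|p3| - l * `|q3|).
  rewrite normrM sqrrB !exprMn !real_normK ?num_real //.
  by lra.
by lra.
Qed.

(** The scalar inequality applied to p = A - l^2 B and q = L^2 B - A, for which
(L^2 - l^2) A = L^2 p + l^2 q and (L^2 - l^2) B = p + q. *)
Lemma pencil_ineq A B (l L : R) x v : A^T = A -> B^T = B ->
  0 < l -> l < L -> L ^+ 2 + l ^+ 2 <= 6 * L * l ->
  (forall z, l ^+ 2 * quadf B z <= quadf A z) ->
  (forall z, quadf A z <= L ^+ 2 * quadf B z) ->
  0 <= quadf A v * quadf B x + quadf A x * quadf B v
       + 4 * bform A x v * bform B x v.
Proof.
move=> sA sB l0 lL hlL hl hL.
have sym s t : (s *: A - t *: B)^T = s *: A - t *: B.
  by rewrite linearB !linearZ /= sA sB.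
have pP : possemidefmx (1 *: A - l ^+ 2 *: B).
  by split=> // z; rewrite quadf_pencil mul1r subr_ge0.
have pQ : possemidefmx (- 1 *: A - (- L ^+ 2) *: B).
  by split=> // z; rewrite quadf_pencil !mulNr mul1r opprK addrC subr_ge0.
have L0 : 0 < L := lt_trans l0 lL.
have := pencil_scalar_ineq l0 L0 hlL (pP.2 x) (pP.2 v)
  (psd_CauchySchwarz x v pP) (pQ.2 x) (pQ.2 v) (psd_CauchySchwarz x v pQ).
rewrite !quadf_pencil !bform_pencil.
have D0 : 0 < (L ^+ 2 - l ^+ 2) ^+ 2.
  by rewrite exprn_gt0 // subr_gt0 ltr_pXn2r // nnegrE ltW.
set E := (X in _ -> 0 <= X) => hE; rewrite -(pmulr_rge0 E D0).
by apply: le_trans hE _; rewrite le_eqVlt; apply/orP; left; apply/eqP; rewrite /E; ring.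
Qed.

(** Along y + s d the product is a quartic f with f'' >= 0. The gap
s f(1) + (1 - s) f(0) - f(s) is s (1 - s) times a weighted mean of f'', with
total weight 1/2 and barycentre (1 + s) / 3; as f'' is quadratic, evaluating it
at the barycentre leaves only a multiple of its leading coefficient
12 a(d) b(d) >= 0. *)
Lemma convex_quadf_mul A B : possemidefmx A -> possemidefmx B ->
  (forall x v, 0 <= quadf A v * quadf B x + quadf A x * quadf B v
       + 4 * bform A x v * bform B x v) ->
  @convex_function R 'cV[R]_n setT (fun x => quadf A x * quadf B x).
Proof.
move=> [sA pA] [sB pB] hE t x y _ _.
suff h (s : R) : 0 <= s -> s <= 1 ->
    quadf A (s *: x + (1 - s) *: y) * quadf B (s *: x + (1 - s) *: y) <=
    s * (quadf A x * quadf B x) + (1 - s) * (quadf A y * quadf B y).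
  exact: (h t%:num).
move=> s0 s1; pose d := x - y; pose m := (1 + s) / 3.
have -> : s *: x + (1 - s) *: y = y + s *: d.
  by rewrite /d scalerBr scalerBl scale1r addrCA.
have -> : quadf A x * quadf B x =
    quadf A (y + 1 *: d) * quadf B (y + 1 *: d).
  by rewrite /d scale1r addrC subrK.
have := hE (y + m *: d) d; have := mulr_ge0 (pA d) (pB d).
rewrite !quadfDZ // !bformDl !bformZl -!quadfE.
move: (quadf A y) (quadf A d) (quadf B y) (quadf B d) (bform A y d) (bform B y d).
move=> a0 a2 b0 b2 a1 b1; set E := (X in _ -> 0 <= X -> _) => ab E0.
have {E0}: 0 <= s * (1 - s) * (E + a2 * b2 * ((1 - s + s ^+ 2) / 3)).
  rewrite mulr_ge0 ?mulr_ge0 ?subr_ge0 // addr_ge0 // mulr_ge0 //.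
  by have := sqr_ge0 (1 - s); nra.
rewrite -subr_ge0 => h; rewrite -subr_ge0; apply: le_trans h _.
by rewrite le_eqVlt; apply/orP; left; apply/eqP; rewrite /E /m; field.
Qed.
End Forms.

(** * The matrix H3 and the theorem *)

Lemma bform_diag (R : realType) (n : nat) (d : 'rV[R]_n) (x y : 'cV[R]_n) :
  bform (diag_mx d) x y = \sum_i d 0 i * (x i 0 * y i 0).
Proof.
rewrite /bform mxE; apply: eq_bigr => i _; rewrite mul_mx_diag !mxE.
by rewrite mulrAC mulrC.
Qed.

(** H3(y) is a quarter of the Hessian at y of the product of the forms
diag(lam) and diag(1 / lam): the coefficients lam_i / lam_j + lam_j / lam_i
come from the cross terms of the product. *)
Lemma quadf_H3 (R : realType) (lam : 'I_3 -> R) (y v : 'cV[R]_3) :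
  (forall i, lam i != 0) ->
  let A := diag_mx (\row_i lam i) in let B := diag_mx (\row_i (lam i)^-1) in
  2 * quadf (H3 lam y) v = quadf A v * quadf B y + quadf A y * quadf B v
    + 4 * bform A y v * bform B y v.
Proof.
move=> lam0 A B; rewrite {}/A {}/B !quadfE !bform_diag.
rewrite /bform !mxE !big_ord_recl !big_ord0 !mxE !big_ord_recl !big_ord0.
rewrite !mxE.
rewrite !(big_mkcond (fun k => k != _)) /= !big_ord_recl !big_ord0 /= /Delta.
have := lam0 ord0; have := lam0 (lift ord0 ord0).
have := lam0 (lift ord0 (lift ord0 ord0)).
move=> h2 h1 h0.
by field; rewrite h0 h1 h2.
Qed.

Theorem theorem4p7 (R : realType) (A : 'M[R]_3) (hA : posdefmx A)
    (hkappa : cond_number A <= 2 + Num.sqrt 3) :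
  (forall lam : 'I_3 -> R, ordered_eigenvalues A lam ->
     forall y : 'cV[R]_3, possemidefmx (H3 lam y)) /\
  @convex_function R 'cV[R]_3 setT (Kfun A).
Proof.
have [/andP[l0 lL] hl hL hb] := spectral_bounds (isT : (0 < 3)%N) hA.
have hB := posdef_invmx hA.
move: hkappa lL hl hL hb; rewrite /cond_number ler_pdivrMr //.
(* L is enlarged to M = (2 + sqrt 3) l, so that l < M even when A is scalar. *)
move: (lambda_min A) (lambda_max A) l0 => l L l0 LM lL hl hL hb.
set M := _ * l in LM.
have s3 : Num.sqrt 3 ^+ 2 = 3 :> R by rewrite sqr_sqrtr.
have s0 : 0 <= Num.sqrt 3 :> R by rewrite sqrtr_ge0.
have lM : l < M by rewrite /M -[X in X < _]mul1r ltr_pM2r //; lra.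
have M0 : 0 < M := lt_trans l0 lM.
have MlE : M ^+ 2 + l ^+ 2 = 4 * M * l.
  have -> : M ^+ 2 + l ^+ 2 = (4 + 4 * Num.sqrt 3 + Num.sqrt 3 ^+ 2 + 1) * l ^+ 2.
    by rewrite /M; ring.
  by rewrite s3 /M; ring.
have hMl : M ^+ 2 + l ^+ 2 <= 6 * M * l.
  by rewrite MlE; have := mulr_ge0 (ltW M0) (ltW l0); lra.
have sqr_bounds a : l <= a <= M -> l ^+ 2 <= a ^+ 2 <= M ^+ 2.
  case/andP=> la aM; have a0 : 0 < a := lt_le_trans l0 la.
  by rewrite !ler_pXn2r ?nnegrE ?(ltW l0) ?(ltW M0) ?(ltW a0) // la.
split=> [lam [lamA _] y|]; last first.
  apply: convex_quadf_mul (posdef_psd hA) (posdef_psd hB) _ => x v.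
  apply: (pencil_ineq _ _ hA.1 hB.1 l0 lM hMl hl) => z.
  apply: le_trans (hL z) _; rewrite ler_wpM2r ?(posdef_psd hB).2 //.
  by have /sqr_bounds/andP[] : l <= L <= M by rewrite lL.
have lamB i : l <= lam i <= M.
  have /hb/andP[-> /le_trans->//] : eigenvalue A (lam i).
  rewrite eigenvalue_root_char lamA /root horner_prod (bigD1 i) //=.
  by rewrite !hornerE subrr mul0r.
have lam0 i : 0 < lam i by have /andP[/(lt_le_trans l0)] := lamB i.
split=> [|v].
  apply/matrixP => i j; rewrite !mxE eq_sym; have [->//|ij] := eqVneq i j.
  by rewrite /Delta; ring.
have h2 : 0 < 2 :> R by [].
rewrite -(pmulr_rge0 _ h2) quadf_H3 => [|i]; last by rewrite gt_eqF.
apply: (pencil_ineq _ _ _ _ l0 lM hMl); rewrite ?tr_diag_mx // => z;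
  rewrite !quadfE !bform_diag mulr_sumr; apply: ler_sum => i _; rewrite !mxE.
  rewrite mulrA -expr2 ler_wpM2r ?sqr_ge0 // ler_pdivrMr // -expr2.
  by case/andP: (sqr_bounds _ (lamB i)).
rewrite [leRHS]mulrA ler_wpM2r -?expr2 ?sqr_ge0 // ler_pdivlMr // -expr2.
by case/andP: (sqr_bounds _ (lamB i)).
Qed.
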